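(* Let $n\ge 3$ and $k\ge 2$, and let $\mathcal{H}=(V,\mathcal{E})$ be a $k$-uniform hypergraph with $V=\{1,\dots,n\}$ and $EI(\mathcal{H})=C_n$. If $\mathcal{H}$ is $3$-regular, then $|\mathcal{E}|\le|\mathcal{E}'|$ for every $k$-uniform hypergraph $\mathcal{H}'=(V,\mathcal{E}')$ with $EI(\mathcal{H}')=C_n$; that is, $|\mathcal{E}|=\mu^k_n$.
   Context: Hypergraphs $\mathcal{H}=(V,\mathcal{E})$ have no multiple hyperedges (hyperedges form a set of subsets of $V$); isolated vertices are allowed. $\mathcal{H}$ is $k$-uniform if every hyperedge has exactly $k$ elements; the degree $d_{\mathcal{H}}(v)$ is the number of hyperedges containing $v$, and $\mathcal{H}$ is $r$-regular if every vertex has degree $r$. The edge intersection hypergraph of $\mathcal{H}$ is $EI(\mathcal{H})=(V,\mathcal{E}^{EI})$ with $\mathcal{E}^{EI}=\{e_1\cap e_2: e_1,e_2\in\mathcal{E},\ e_1\ne e_2,\ |e_1\cap e_2|\ge 2\}$. $C_n$ is the cycle with vertex set $\{1,\dots,n\}$ and edge set $\{\{i,i+1\}: i=1,\dots,n\}$ (indices mod $n$); ''$EI(\mathcal{H})=C_n$'' means $V=\{1,\dots,n\}$ and $\mathcal{E}^{EI}$ equals the edge set of $C_n$. $\mu^k_n$ denotes the minimum of $|\mathcal{E}|$ over all $k$-uniform hypergraphs $\mathcal{H}=(V,\mathcal{E})$ with $EI(\mathcal{H})=C_n$. *)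

(* Defs.v *)
From mathcomp Require Import all_boot.

Set Implicit Arguments.
Unset Strict Implicit.
Unset Printing Implicit Defensive.

(* A hypergraph with vertex set the whole finite type V is identified with its
   set of hyperedges: no multiple hyperedges, isolated vertices allowed. *)
Definition hypergraph (V : finType) : Type := {set {set V}}.

Definition uniform (V : finType) (k : nat) (E : hypergraph V) : bool :=
  [forall e in E, #|e| == k].

Definition hdegree (V : finType) (E : hypergraph V) (v : V) : nat :=
  #|[set e in E | v \in e]|.

Definition regular (V : finType) (r : nat) (E : hypergraph V) : bool :=
  [forall v, hdegree E v == r].

Definition EI (V : finType) (E : hypergraph V) : hypergraph V :=
  [set e1 :&: e2 | e1 in E, e2 in E & (e1 != e2) && (2 <= #|e1 :&: e2|)].

(* The vertices 1, ..., n are represented by 0, ..., n - 1 in 'I_n; ordS is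
   the successor modulo n. For n >= 3 this is the usual n-cycle. *)
Definition cycle_edges (n : nat) : hypergraph 'I_n :=
  [set [set i; ordS i] | i : 'I_n].

(* The minimum number of hyperedges of a k-uniform hypergraph whose edge
   intersection hypergraph is C_n. The value is 0 by convention when no such
   hypergraph exists (arg min then returns its default set0). *)
Definition mu (k n : nat) : nat :=
  #|[arg min_(E < (set0 : {set {set 'I_n}})
       | uniform k E && (EI E == cycle_edges n)) #|E|]|.

(* Main.v *)
Require Import Defs.
From mathcomp Require Import all_boot.

(* Every vertex of C_n lies on two distinct edges of C_n, and a vertex of degree
    at most 2 lies in at most one intersection of two distinct hyperedges. So
    all degrees are at least 3 whenever EI(E) = C_n, and counting incidences
    gives 3n <= k |E|, with equality when E is 3-regular. *)

Lemma sum_hdegree (V : finType) (k : nat) (E : hypergraph V) :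
  uniform k E -> \sum_v hdegree E v = k * #|E|.
Proof.
move=> /forall_inP unifE.
transitivity (\sum_v \sum_(e in E | v \in e) 1).
  by apply: eq_bigr => v _; rewrite sum1dep_card.
rewrite (exchange_big_dep (mem E)) /=; last by move=> v e _ /andP[].
rewrite mulnC -sum_nat_const; apply: eq_bigr => e eE.
rewrite -(eqP (unifE e eE)) -sum1_card.
by apply: eq_bigl => v; rewrite eE.
Qed.

Lemma EI_hdegree_ge3 (V : finType) (E : hypergraph V) (v : V) (a b : {set V}) :
  a \in EI E -> b \in EI E -> a != b -> v \in a -> v \in b -> 3 <= hdegree E v.
Proof.
(* With degree at most 2, [e1] and [e2] are all the hyperedges through [v], so the right-hand side
   does not depend on the chosen pair. *)
have eq_star (e1 e2 : {set V}) : e1 \in E -> e2 \in E -> e1 != e2 ->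
    v \in e1 :&: e2 -> hdegree E v < 3 ->
    e1 :&: e2 = \bigcap_(e in [set e in E | v \in e]) e.
  move=> e1E e2E ne12 /setIP[ve1 ve2] deg_lt3.
  suff <- : [set e1; e2] = [set e in E | v \in e].
    by rewrite bigcap_setU !big_set1.
  apply/eqP; rewrite eqEcard cards2 ne12 andbC -ltnS deg_lt3 /=.
  by apply/subsetP => e /set2P[] ->; rewrite inE ?e1E ?e2E.
case/imset2P => e1 e2 e1E; rewrite inE => /and3P[e2E ne12 _] ->.
case/imset2P => f1 f2 f1E; rewrite inE => /and3P[f2E nf12 _] ->.
move=> neq_ab va vb; rewrite leqNgt; apply: contra neq_ab => deg_lt3.
by rewrite (eq_star e1 e2) // (eq_star f1 f2).
Qed.

Lemma ordS_ordS_neq (n : nat) (i : 'I_n) : 3 <= n -> ordS (ordS i) != i.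
Proof.
move=> n_ge3; apply/eqP => /(congr1 val) /=.
(* Cancelling [i] from i + 2 = i modulo n leaves 2 = 0 modulo n, impossible since 2 < n. *)
rewrite -addn1 modnDml addn1 -addn2 => eq_i.
have := eqn_modDl i 2 0 n.
by rewrite addn0 eq_i [i %% n]modn_small // eqxx mod0n modn_small.
Qed.

Lemma ordS_neq (n : nat) (i : 'I_n) : 3 <= n -> ordS i != i.
Proof.
by move=> n_ge3; apply: contra (ordS_ordS_neq n i n_ge3) => /eqP Si; rewrite !Si.
Qed.

Lemma EI_cycle_hdegree_ge3 (n : nat) (E : hypergraph 'I_n) (v : 'I_n) :
  3 <= n -> EI E = cycle_edges n -> 3 <= hdegree E v.
Proof.
(* Writing [v] as [ordS u] gives both cycle edges at [v] the shape used in [cycle_edges]. *)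
move=> n_ge3 EIE; rewrite -[v]ord_predK; set u := ord_pred v.
apply: (@EI_hdegree_ge3 _ E _ [set u; ordS u] [set ordS u; ordS (ordS u)]).
- by rewrite EIE; apply: imset_f.
- by rewrite EIE; apply: imset_f.
(* The vertex [u] separates the two edges: it lies only in the first. *)
- apply/eqP => /setP /(_ u); rewrite !inE eqxx /=.
  by rewrite ![u == _]eq_sym (negPf (ordS_neq _ _ _)) ?(negPf (ordS_ordS_neq _ _ _)).
- by rewrite !inE eqxx orbT.
- by rewrite !inE eqxx.
Qed.

Lemma mu_eq (n k : nat) (E : hypergraph 'I_n) :
  uniform k E -> EI E = cycle_edges n ->
  (forall E' : hypergraph 'I_n,
     uniform k E' -> EI E' = cycle_edges n -> #|E| <= #|E'|) ->
  mu k n = #|E|.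
Proof.
(* The default [set0] is inadmissible for n > 0, as [EI set0] is empty, so the search behind arg min
   is unfolded. If it finds some [F], then [E] and [F] bound each other; it cannot fail, since [E]
   itself is a minimizer. *)
move=> unifE EIE minE; rewrite /mu /arg_min /extremum.
case: pickP => [F /andP[/andP[unifF /eqP EIF] /forall_inP minF] | /(_ E)] /=.
  by apply/eqP; rewrite eqn_leq minE // andbT minF // unifE EIE eqxx.
rewrite unifE EIE eqxx /= => /forall_inP[] F /andP[unifF /eqP EIF].
exact: minE.
Qed.

Theorem theorem1 (n k : nat) (hn : 3 <= n) (hk : 2 <= k)
    (E : hypergraph 'I_n)
    (hunif : uniform k E) (hEI : EI E = cycle_edges n)
    (hreg : regular 3 E) :
  (forall E' : hypergraph 'I_n,
     uniform k E' -> EI E' = cycle_edges n -> #|E| <= #|E'|)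
  /\ #|E| = mu k n.
Proof.
have minE (E' : hypergraph 'I_n) :
    uniform k E' -> EI E' = cycle_edges n -> #|E| <= #|E'|.
  move=> unifE' EIE'; have k_gt0 : 0 < k by apply: ltnW.
  (* Multiplied by [k], both sizes become degree sums, which are compared vertex by vertex. *)
  rewrite -(leq_pmul2l k_gt0) -!sum_hdegree //.
  apply: leq_sum => v _; rewrite (eqP (forallP hreg v)).
  exact: EI_cycle_hdegree_ge3.
by split=> //; rewrite (@mu_eq n k E).
Qed.
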